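(* Let $G_\omega$ be a weighted graph with vertex set $V=\{v_1,\dots,v_n\}$ ($n\ge 1$), let $r\geq 1$ be an integer, let $A$ be a non-zero commutative ring, and let $S=A[X_1,\dots,X_n]$. Then $$I_{r}(G_\omega)=\bigcap_{(W,\sigma)}P_{(W,\sigma)}=\bigcap_{(W,\sigma)\ \text{min}} P_{(W,\sigma)}$$ where the first intersection is taken over all weighted $r$-path vertex covers of $G_\omega$, and the second intersection is taken over all minimal weighted $r$-path vertex covers of $G_\omega$. Moreover, the second intersection is irredundant.
   Context: $\mathbb{N}=\{1,2,\dots\}$. Graphs are finite and simple. A weighted graph $G_\omega$ is a graph $G$ with vertex set $V=\{v_1,\dots,v_n\}$ and edge set $E$, together with a function $\omega\colon E\to\mathbb{N}$. An $r$-path in $G$ is a sequence $v_{i_1}\dots v_{i_{r+1}}$ of distinct vertices such that $v_{i_j}v_{i_{j+1}}\in E$ for $j=1,\dots,r$. The weighted $r$-path ideal $I_r(G_\omega)$ is the ideal of $S$ generated by the monomials $X_{i_1}^{e_{i_1}}\cdots X_{i_{r+1}}^{e_{i_{r+1}}}$, one for each $r$-path $v_{i_1}\dots v_{i_{r+1}}$ in $G$, where $e_{i_1}=\omega(v_{i_1}v_{i_2})$, $e_{i_j}=\max\{\omega(v_{i_{j-1}}v_{i_j}),\omega(v_{i_j}v_{i_{j+1}})\}$ for $1<j\leq r$, and $e_{i_{r+1}}=\omega(v_{i_r}v_{i_{r+1}})$. Let $\Lambda=\{(W,\sigma)\mid W\subseteq V,\ \sigma\colon W\to\mathbb{N}\}$.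 For $(W,\sigma)\in\Lambda$ set $P_{(W,\sigma)}=(X_i^{\sigma(v_i)}\mid v_i\in W)S$. A weighted $r$-path vertex cover of $G_\omega$ is a pair $(W,\sigma)\in\Lambda$ such that for every $r$-path $v_{i_1}\dots v_{i_{r+1}}$ in $G$ there is an index $j$ with $v_{i_j}\in W$ and one of the following: $j=1$ and $\sigma(v_{i_1})\le\omega(v_{i_1}v_{i_2})$; or $j=r+1$ and $\sigma(v_{i_{r+1}})\le\omega(v_{i_r}v_{i_{r+1}})$; or $1<j\le r$ and $\sigma(v_{i_j})\le\max\{\omega(v_{i_{j-1}}v_{i_j}),\omega(v_{i_j}v_{i_{j+1}})\}$. For $(W,\sigma),(W',\sigma')\in\Lambda$, write $(W',\sigma')\le(W,\sigma)$ if $W'\subseteq W$ and $\sigma(v_i)\le\sigma'(v_i)$ for all $v_i\in W'$. A weighted $r$-path vertex cover is minimal if it is minimal with respect to this ordering among all weighted $r$-path vertex covers of $G_\omega$. An intersection of ideals of the form $P_{(W,\sigma)}$ is irredundant if no ideal in it is contained in any other ideal in it. *)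

(* Defs.v *)
From HB Require Import structures.
From mathcomp Require Import all_boot all_algebra.
From mathcomp Require Import mpoly.

Set Implicit Arguments.
Unset Strict Implicit.
Unset Printing Implicit Defensive.

Import GRing.Theory.
Local Open Scope ring_scope.

(* A weighted graph on the vertex set 'I_n.  [weight G i j] is meaningful only
   when [adj G i j] holds; its values elsewhere are never used. *)
Record wgraph (n : nat) := WGraph {
  adj : rel 'I_n;
  weight : 'I_n -> 'I_n -> nat;
  adj_sym : ssrbool.symmetric adj;
  adj_irr : irreflexive adj;
  weight_sym : forall i j, adj i j -> weight i j = weight j i;
  weight_gt0 : forall i j, adj i j -> (0 < weight i j)%N
}.

Definition is_rpath n r (G : wgraph n) (p : r.+1.-tuple 'I_n) : bool :=
  uniq p && sorted (adj G) p.

(* The weight of the step from position k to position k+1 of p, for k < r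
   (positions are numbered from 0). *)
Definition step_weight n r (G : wgraph n) (p : r.+1.-tuple 'I_n) (k : nat) :
  nat := weight G (tnth p (inord k)) (tnth p (inord k.+1)).

(* The exponent, in the monomial of p, of the vertex at position j. For r >= 1
   the first two cases are exclusive. *)
Definition rpath_exp n r (G : wgraph n) (p : r.+1.-tuple 'I_n)
    (j : 'I_r.+1) : nat :=
  if j == 0%N :> nat then step_weight G p 0%N
  else if j == r :> nat then step_weight G p r.-1
  else maxn (step_weight G p j.-1) (step_weight G p j).

Definition ideal_gen (R : comNzRingType) (M : R -> Prop) (f : R) : Prop :=
  exists (k : nat) (a g : 'I_k -> R),
    (forall i, M (g i)) /\ f = \sum_(i < k) a i * g i.

Definition ideal_eq (R : comNzRingType) (I J : R -> Prop) : Prop :=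
  forall f, I f <-> J f.

Definition ideal_sub (R : comNzRingType) (I J : R -> Prop) : Prop :=
  forall f, I f -> J f.

Definition ideal_bigcap (R : comNzRingType) (T : Type) (D : T -> Prop)
    (I : T -> R -> Prop) (f : R) : Prop :=
  forall t, D t -> I t f.

Definition rpath_monomial (A : comNzRingType) n r (G : wgraph n)
    (p : r.+1.-tuple 'I_n) : {mpoly A[n]} :=
  \prod_(j < r.+1) 'X_(tnth p j) ^+ rpath_exp G p j.

Definition rpath_ideal (A : comNzRingType) n r (G : wgraph n) :
    {mpoly A[n]} -> Prop :=
  ideal_gen (fun m => exists p : r.+1.-tuple 'I_n,
    is_rpath G p /\ m = rpath_monomial A G p).

(* The pairs (W, sigma) with W a set of vertices and sigma : W -> {1, 2, ...}. *)
Record wvset (n : nat) := WVSet {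
  supp : {set 'I_n};
  expo : {ffun {i : 'I_n | i \in supp} -> nat};
  expo_gt0 : forall x, (0 < expo x)%N
}.

Definition wvset_ideal (A : comNzRingType) n (c : wvset n) :
    {mpoly A[n]} -> Prop :=
  ideal_gen (fun m => exists x : {i : 'I_n | i \in supp c},
    m = 'X_(val x) ^+ expo c x).

Definition is_cover n r (G : wgraph n) (c : wvset n) : Prop :=
  forall p : r.+1.-tuple 'I_n, is_rpath G p ->
    exists (j : 'I_r.+1) (hj : tnth p j \in supp c),
      (expo c (exist _ (tnth p j) hj) <= rpath_exp G p j)%N.

Definition wvset_le n (c' c : wvset n) : Prop :=
  (supp c' \subset supp c) /\
  forall i (hi' : i \in supp c') (hi : i \in supp c),
    (expo c (exist _ i hi) <= expo c' (exist _ i hi'))%N.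

Definition is_min_cover n r (G : wgraph n) (c : wvset n) : Prop :=
  is_cover r G c /\
  forall c', is_cover r G c' -> wvset_le c' c -> c' = c.

(* Redundancy is a property of the indexed family: distinct indices must give
   incomparable ideals, so in particular distinct ideals. *)
Definition irredundant (R : comNzRingType) (T : Type) (D : T -> Prop)
    (I : T -> R -> Prop) : Prop :=
  forall t t', D t -> D t' -> t <> t' -> ~ ideal_sub (I t) (I t').

(* Main.v *)
Require Import Defs.
From mathcomp Require Import all_boot all_algebra mpoly.
From Stdlib Require Import Classical FunctionalExtensionality.

(** All the ideals involved are monomial, so membership of f is decided by the
    exponent vectors of the monomials of f: a vector u lies in I_r iff it
    dominates the exponents of some r-path, and in P_(W,sigma) iff
    sigma(i) <= u(i) for some i in W. If u dominates no r-path, then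
    (V, u + 1) is a weighted cover whose ideal misses u. A cover dominates a
    minimal one because vertices whose exponent exceeds every path exponent can
    be dropped, after which only finitely many covers remain below. Finally
    P_c <= P_c' forces c <= c', whence irredundancy. *)

Set Implicit Arguments.
Unset Strict Implicit.
Unset Printing Implicit Defensive.

Import GRing.Theory.
Local Open Scope ring_scope.

(** * Membership in monomial ideals and in the path ideal *)

Lemma mem_monomial_ideal (A : comNzRingType) n (M : {mpoly A[n]} -> Prop)
    (E : 'X_{1..n} -> Prop) (f : {mpoly A[n]}) :
    (forall g, M g <-> exists2 m, E m & g = 'X_[m]) ->
  ideal_gen M f <-> forall u, u \in msupp f -> exists2 m, E m & (m <= u)%MM.
Proof.
move=> ME; split.
  case=> k [a [g [Mg ->]]] u; rewrite mcoeff_msupp linear_sum /= => fu_neq0.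
  (* The coefficient of [f] at [u] is nonzero, so it cannot vanish in every summand. *)
  have [i agu_neq0] : exists i, (a i * g i)@_u != 0.
    apply/existsP; apply: contraNT fu_neq0; rewrite negb_exists => /forallP z.
    by rewrite big1 // => i _; apply/eqP; rewrite -[_ == _]negbK z.
  have [m Em g_eq] := (ME _).1 (Mg i); exists m => //.
  move: agu_neq0; rewrite -mcoeff_msupp g_eq (perm_mem (msuppMX _ _)).
  by case/mapP=> m' _ ->; rewrite lem_addr.
move=> dom.
pose u (i : 'I_(size (msupp f))) := tnth (in_tuple (msupp f)) i.
have /fin_all_exists [m Em] i : exists m, E m /\ (m <= u i)%MM.
  by have [|m ? ?] := dom (u i); [exact: mem_tnth | exists m].
(* Each term of [f] is split as its coefficient times ['X_[u i - m i]] times the generator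
   ['X_[m i]]. The generators are monic, so nothing is divided in [A]. *)
exists (size (msupp f)), (fun i => f@_(u i) *: 'X_[u i - m i]).
exists (fun i => 'X_[m i]); split.
  by move=> i; apply/ME; exists (m i) => //; case: (Em i).
rewrite {1}[f]mpolyE big_tnth; apply: eq_bigr => i _.
by rewrite -scalerAl -mpolyXD submK //; case: (Em i).
Qed.

Definition rpath_mnm n r (G : wgraph n) (p : r.+1.-tuple 'I_n) : 'X_{1..n} :=
  (\sum_(j < r.+1) U_(tnth p j) *+ rpath_exp G p j)%MM.

Lemma rpath_monomialE (A : comNzRingType) n r (G : wgraph n)
    (p : r.+1.-tuple 'I_n) : rpath_monomial A G p = 'X_[rpath_mnm G p].
Proof. by rewrite /rpath_monomial mprodXnE. Qed.

(** The vertices of a path are distinct, so only position [j] contributes to the exponent of its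
    vertex. *)
Lemma rpath_mnm_tnth n r (G : wgraph n) (p : r.+1.-tuple 'I_n) (j : 'I_r.+1) :
  uniq p -> rpath_mnm G p (tnth p j) = rpath_exp G p j.
Proof.
move=> /tuple_uniqP p_inj; rewrite mnm_sumE (bigD1 j) //= big1 => [|k k_neq_j].
  by rewrite mulmnE mnm1E eqxx mul1n addn0.
by rewrite mulmnE mnm1E (inj_eq p_inj) (negPf k_neq_j) mul0n.
Qed.

Lemma rpath_mnm_le n r (G : wgraph n) (p : r.+1.-tuple 'I_n) (u : 'X_{1..n}) :
  uniq p ->
  (rpath_mnm G p <= u)%MM = [forall j, rpath_exp G p j <= u (tnth p j)]%N.
Proof.
move=> p_uniq; apply/mnm_lepP/forallP => [le_pu j | le_pu i].
  by rewrite -(rpath_mnm_tnth G j p_uniq).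
have [/tnthP[j ->] | i_notin_p] := boolP (i \in p).
  by rewrite rpath_mnm_tnth.
rewrite mnm_sumE big1 // => j _; rewrite mulmnE mnm1E.
by case: eqP i_notin_p => // <-; rewrite mem_tnth.
Qed.

Lemma mem_rpath_ideal (A : comNzRingType) n r (G : wgraph n)
    (f : {mpoly A[n]}) :
  rpath_ideal r G f <->
  forall u, u \in msupp f -> exists2 p : r.+1.-tuple 'I_n, is_rpath G p &
    forall j, (rpath_exp G p j <= u (tnth p j))%N.
Proof.
rewrite /rpath_ideal (@mem_monomial_ideal _ _ _ (fun m =>
  exists2 p : r.+1.-tuple 'I_n, is_rpath G p & m = rpath_mnm G p)); last first.
  move=> g; split=> [[p [Gp ->]] | [_ [p Gp ->] ->]].
    by exists (rpath_mnm G p); [exists p | rewrite rpath_monomialE].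
  by exists p; rewrite rpath_monomialE.
split=> dom u /dom.
  case=> _ [p Gp ->]; exists p => //; apply/forallP.
  by rewrite -rpath_mnm_le //; case/andP: Gp.
case=> p Gp /forallP le_pu; exists (rpath_mnm G p); first by exists p.
by rewrite rpath_mnm_le //; case/andP: Gp.
Qed.

(** * Weighted vertex sets as exponent functions *)

(* A pair (W, sigma) is encoded by the function equal to sigma on W and to 0
   off W; this removes the dependency of sigma on W. *)
Definition wexp n (c : wvset n) (i : 'I_n) : nat :=
  if insub i is Some x then expo c x else 0.

Lemma wexpE n (c : wvset n) i (hi : i \in supp c) :
  wexp c i = expo c (exist _ i hi).
Proof. by rewrite /wexp insubT. Qed.

Lemma wexp_gt0 n (c : wvset n) i : (0 < wexp c i)%N = (i \in supp c).
Proof.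
have [hi | hi] := boolP (i \in supp c); first by rewrite wexpE expo_gt0.
by rewrite /wexp insubN.
Qed.

(** Minimality is stated with equality of records, so the positivity proofs must be identified too.
    They prove boolean equalities, hence agree pointwise, and functional extensionality
    concludes. *)
Lemma wexp_inj n (c c' : wvset n) : wexp c =1 wexp c' -> c = c'.
Proof.
move=> eq_cc'.
have eq_supp : supp c = supp c' by apply/setP => i; rewrite -!wexp_gt0 eq_cc'.
case: c c' eq_supp eq_cc' => [W s s_gt0] [W' s' s'_gt0] /= eq_supp.
case: _ / eq_supp s' s'_gt0 => s' s'_gt0 eq_ss'.
have eq_s : s = s' by apply/ffunP => -[i hi]; have := eq_ss' i; rewrite !wexpE.
case: _ / eq_s s'_gt0 {eq_ss'} => s'_gt0; congr WVSet.
by apply: functional_extensionality_dep => x; apply: eq_irrelevance.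
Qed.

Lemma wvset_of_expo_gt0 n (t : 'I_n -> nat)
    (x : {i : 'I_n | i \in [set i | 0 < t i]%N}) :
  (0 < [ffun x : {i : 'I_n | i \in [set i | 0 < t i]%N} => t (val x)] x)%N.
Proof. by rewrite ffunE; case: x => i /=; rewrite inE. Qed.

Definition wvset_of n (t : 'I_n -> nat) : wvset n :=
  WVSet (@wvset_of_expo_gt0 n t).

Lemma wexp_wvset_of n (t : 'I_n -> nat) : wexp (wvset_of t) =1 t.
Proof.
move=> i; have [t_gt0 | t_le0] := boolP (0 < t i)%N.
  have hi : i \in supp (wvset_of t) by rewrite inE.
  by rewrite (wexpE hi) ffunE.
rewrite /wexp insubN ?inE //.
by move: t_le0; rewrite -eqn0Ngt => /eqP.
Qed.

Lemma wvset_leP n (c' c : wvset n) : wvset_le c' c <->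
  forall i, (0 < wexp c' i)%N -> (0 < wexp c i <= wexp c' i)%N.
Proof.
split=> [[/subsetP sub le_e] i | le_e].
  rewrite !wexp_gt0 => hi'; rewrite (sub _ hi') /=.
  by rewrite (wexpE (sub _ hi')) (wexpE hi') le_e.
split; first by apply/subsetP => i; rewrite -!wexp_gt0 => /le_e/andP[].
by move=> i hi' hi; have := le_e i; rewrite !wexpE !expo_gt0; apply.
Qed.

Lemma wvset_le_trans n (c1 c2 c3 : wvset n) :
  wvset_le c1 c2 -> wvset_le c2 c3 -> wvset_le c1 c3.
Proof.
move=> /wvset_leP le12 /wvset_leP le23; apply/wvset_leP => i /le12/andP[].
by move=> /le23/andP[-> /leq_trans le13] /le13.
Qed.

Lemma is_coverP n r (G : wgraph n) (c : wvset n) : is_cover r G c <->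
  forall p : r.+1.-tuple 'I_n, is_rpath G p ->
    exists j, (0 < wexp c (tnth p j) <= rpath_exp G p j)%N.
Proof.
split=> cov p /cov.
  by case=> j [hj le_e]; exists j; rewrite wexp_gt0 hj (wexpE hj).
case=> j; rewrite wexp_gt0 => /andP[hj]; rewrite (wexpE hj) => le_e.
by exists j, hj.
Qed.

(** * The ideals of weighted vertex sets and their inclusions *)

Lemma mem_wvset_ideal (A : comNzRingType) n (c : wvset n) (f : {mpoly A[n]}) :
  wvset_ideal c f <->
  forall u, u \in msupp f -> exists i, (0 < wexp c i <= u i)%N.
Proof.
rewrite /wvset_ideal (@mem_monomial_ideal _ _ _ (fun m =>
  exists2 i, i \in supp c & m = (U_(i) *+ wexp c i)%MM)); last first.
  move=> g; split=> [[[i hi] ->] | [_ [i hi ->] ->]].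
    by exists (U_(i) *+ wexp c i)%MM; [exists i | rewrite mpolyXn -wexpE].
  by exists (exist _ i hi); rewrite mpolyXn -wexpE.
split=> dom u /dom.
  case=> _ [i hi ->] /mnm_lepP/(_ i); rewrite mulmnE mnm1E eqxx mul1n => le_u.
  by exists i; rewrite wexp_gt0 hi.
case=> i /andP[]; rewrite wexp_gt0 => hi le_u.
exists (U_(i) *+ wexp c i)%MM; first by exists i.
apply/mnm_lepP => j; rewrite mulmnE mnm1E.
by case: eqP => [<-|_]; rewrite ?mul1n ?mul0n.
Qed.

(** The inclusion is tested on each generator of the smaller ideal: a pure power of one variable can
    only be divisible by a generator in that same variable. *)
Lemma wvset_ideal_sub_le (A : comNzRingType) n (c c' : wvset n) :
  ideal_sub (@wvset_ideal A n c) (wvset_ideal c') -> wvset_le c c'.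
Proof.
move=> sub; apply/wvset_leP => i c_gt0.
have Xc : @wvset_ideal A n c 'X_[U_(i) *+ wexp c i].
  apply/mem_wvset_ideal => u; rewrite msuppX inE => /eqP->.
  by exists i; rewrite mulmnE mnm1E eqxx mul1n c_gt0 leqnn.
have /mem_wvset_ideal/(_ (U_(i) *+ wexp c i)%MM) := sub _ Xc.
rewrite msuppX mem_head => /(_ isT) [j]; rewrite mulmnE mnm1E.
case: eqP => [<-|_]; first by rewrite mul1n.
by rewrite mul0n ltnNge andNb.
Qed.

Lemma wvset_le_ideal_sub (A : comNzRingType) n (c c' : wvset n) :
  wvset_le c c' -> ideal_sub (@wvset_ideal A n c) (wvset_ideal c').
Proof.
move=> /wvset_leP le_c f /mem_wvset_ideal cf; apply/mem_wvset_ideal => u.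
by case/cf=> i /andP[/le_c/andP[c'_gt0 le_c'] le_u]; exists i;
  rewrite c'_gt0 (leq_trans le_c').
Qed.

(** * Existence of minimal covers *)

Definition max_rpath_exp n r (G : wgraph n) : nat :=
  \max_(p : r.+1.-tuple 'I_n) \max_(j < r.+1) rpath_exp G p j.

Lemma leq_max_rpath_exp n r (G : wgraph n) (p : r.+1.-tuple 'I_n) j :
  (rpath_exp G p j <= max_rpath_exp r G)%N.
Proof.
apply: leq_trans (leq_bigmax (F := fun q : r.+1.-tuple 'I_n =>
  \max_(j < r.+1) rpath_exp G q j) p).
exact: leq_bigmax.
Qed.

Definition wvset_trunc n (N : nat) (c : wvset n) : wvset n :=
  wvset_of (fun i => if (wexp c i <= N)%N then wexp c i else 0%N).

Lemma wvset_trunc_le n N (c : wvset n) : wvset_le (wvset_trunc N c) c.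
Proof.
by apply/wvset_leP => i; rewrite wexp_wvset_of;
  case: ifP => // _ ->; apply: leqnn.
Qed.

Lemma wexp_trunc_le n N (c : wvset n) i : (wexp (wvset_trunc N c) i <= N)%N.
Proof. by rewrite wexp_wvset_of; case: ifP. Qed.

(** A vertex that covers a path has exponent at most a path exponent, so it survives truncation. *)
Lemma is_cover_trunc n r (G : wgraph n) (c : wvset n) :
  is_cover r G c -> is_cover r G (wvset_trunc (max_rpath_exp r G) c).
Proof.
move=> /is_coverP cov; apply/is_coverP => p /cov [j /andP[c_gt0 le_c]].
exists j; rewrite wexp_wvset_of.
by rewrite (leq_trans le_c (leq_max_rpath_exp G p j)) c_gt0.
Qed.

(** A termination measure: going down in the order raises exponents or drops vertices. With [N.+1],
    a vertex of exponent [N] still counts 1, so dropping it lowers the sum. *)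
Definition wvset_size n (N : nat) (c : wvset n) : nat :=
  \sum_i (if 0 < wexp c i then N.+1 - wexp c i else 0)%N.

Lemma wvset_size_lt n N (c' c : wvset n) : (forall i, wexp c i <= N)%N ->
  wvset_le c' c -> c' <> c -> (wvset_size N c' < wvset_size N c)%N.
Proof.
move=> c_leN /wvset_leP le_c neq_c.
pose w (d : wvset n) i := (if 0 < wexp d i then N.+1 - wexp d i else 0)%N.
have le_w i : (w c' i <= w c i)%N.
  rewrite /w; case: ifP => // /le_c /andP[-> le_e]; exact: leq_sub2l.
have [i neq_i] : exists i, wexp c' i != wexp c i.
  apply/existsP; apply: contra_notT neq_c; rewrite negb_exists => /forallP eq_c.
  by apply: wexp_inj => i; apply/eqP; rewrite -[_ == _]negbK eq_c.
have lt_w : (w c' i < w c i)%N.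
  (* Either [i] stays with a larger exponent or it is dropped. The bound [wexp c i <= N] keeps the
     right side positive; [wexp c' i] may exceed [N], where subtraction gives 0. *)
  move: neq_i (c_leN i); rewrite /w; case: ifPn => [/le_c/andP[-> le_e] | ].
    rewrite neq_ltn ltnNge le_e /= => lt_e leN; apply: ltn_sub2l => //.
  by rewrite -eqn0Ngt => /eqP->; rewrite eq_sym -lt0n => ->; rewrite subn_gt0.
rewrite /wvset_size (bigD1 i) // [ltnRHS](bigD1 i) //=.
rewrite -addSn; apply: leq_add; first exact: lt_w.
by apply: leq_sum => j _; exact: le_w.
Qed.

Lemma exists_min_cover n r (G : wgraph n) (c : wvset n) :
  is_cover r G c -> exists2 c', is_min_cover r G c' & wvset_le c' c.
Proof.
pose N := max_rpath_exp r G.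
suff trunc_case d : (forall i, wexp d i <= N)%N -> is_cover r G d ->
    exists2 c', is_min_cover r G c' & wvset_le c' d.
  move=> /is_cover_trunc/(trunc_case _ (wexp_trunc_le N c)) [c' min_c' le_c'].
  exists c' => //; exact: wvset_le_trans le_c' (wvset_trunc_le N c).
have [m] := ubnP (wvset_size N d); elim: m d => // m IHm d lt_m d_leN cov_d.
have [min_d | not_min] := classic (is_min_cover r G d).
  by exists d => //; apply/wvset_leP => i ->; apply: leqnn.
have [d' [cov_d' le_d' neq_d']] :
    exists d', [/\ is_cover r G d', wvset_le d' d & d' <> d].
  apply: NNPP => no_d'; apply: not_min; split=> // d' cov_d' le_d'.
  by apply: NNPP => neq_d'; apply: no_d'; exists d'.
(* The smaller cover [d'] may have exponents above [N]; truncating it restores the bound required by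
   the induction. *)
pose d2 := wvset_trunc N d'.
have le_d2 : wvset_le d2 d := wvset_le_trans (wvset_trunc_le N d') le_d'.
have neq_d2 : d2 <> d.
  (* If truncation gave back [d], then [d <= d' <= d], and antisymmetry would give [d' = d]. *)
  move=> eq_d2; apply: neq_d'; apply: wexp_inj => i.
  have /wvset_leP le_dd' := wvset_trunc_le N d'.
  rewrite -/d2 eq_d2 in le_dd'; move/wvset_leP in le_d'.
  apply/eqP; have [d_eq0 | ] := posnP (wexp d i); last first.
    by move=> /le_dd'/andP[d'_gt0 ?]; have /andP[_ ?] := le_d' i d'_gt0;
      rewrite eqn_leq; apply/andP.
  by rewrite d_eq0 -leqn0 leqNgt; apply/negP => /le_d'; rewrite d_eq0.
have lt_d2 := wvset_size_lt d_leN le_d2 neq_d2.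
have [|||c' min_c' le_c'] := IHm d2.
- exact: leq_trans lt_d2 lt_m.
- exact: wexp_trunc_le.
- exact: is_cover_trunc.
by exists c' => //; apply: wvset_le_trans le_c' le_d2.
Qed.

(** * The two decompositions and irredundancy *)

Lemma rpath_ideal_bigcap (A : comNzRingType) n r (G : wgraph n) :
  ideal_eq (@rpath_ideal A n r G)
    (ideal_bigcap (@is_cover n r G) (@wvset_ideal A n)).
Proof.
move=> f; split=> [/mem_rpath_ideal If c /is_coverP cov | Pf].
  apply/mem_wvset_ideal => u /If [p /cov [j /andP[c_gt0 le_c]] le_u].
  by exists (tnth p j); rewrite c_gt0 (leq_trans le_c).
apply/mem_rpath_ideal => u fu; apply: NNPP => no_p.
have cov : is_cover r G (wvset_of (fun i => (u i).+1)).
  apply/is_coverP => p Gp.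
  (* Since [u] fails to dominate [p], it is strictly below the path exponent at some position, where
     its successor is still at most that exponent. *)
  suff /existsP[j lt_u] : [exists j, u (tnth p j) < rpath_exp G p j]%N.
    by exists j; rewrite wexp_wvset_of.
  apply: contra_notT no_p; rewrite negb_exists => /forallP le_u.
  by exists p => // j; rewrite leqNgt le_u.
have /mem_wvset_ideal/(_ u fu) [i] := Pf _ cov.
by rewrite wexp_wvset_of ltnn.
Qed.

Theorem theorem1 (n r : nat) (n_ge1 : (1 <= n)%N) (r_ge1 : (1 <= r)%N)
    (G : wgraph n) (A : comNzRingType) :
  [/\ ideal_eq (@rpath_ideal A n r G)
        (ideal_bigcap (@is_cover n r G) (@wvset_ideal A n)),
      ideal_eq (ideal_bigcap (@is_cover n r G) (@wvset_ideal A n))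
        (ideal_bigcap (@is_min_cover n r G) (@wvset_ideal A n))
    & irredundant (@is_min_cover n r G) (@wvset_ideal A n)].
Proof.
split; first exact: rpath_ideal_bigcap.
  move=> f; split=> [Pf c [cov _] | Pf c cov]; first exact: Pf.
  (* The ideal of [c] contains that of a minimal cover below [c], so the non-minimal covers do not
     shrink the intersection. *)
  have [c' min_c' le_c'] := exists_min_cover cov.
  exact: (wvset_le_ideal_sub le_c' (Pf _ min_c')).
(* An inclusion of ideals puts the cover [c] below [c'], and minimality of [c'] makes them equal. *)
move=> c c' [cov_c _] [_ min_c'] neq_c /wvset_ideal_sub_le le_c.
exact: neq_c (min_c' c cov_c le_c).
Qed.
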